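(* Let $$S=\begin{pmatrix}0&1&0&1\\1&0&1&0\end{pmatrix},\qquad S'=\begin{pmatrix}0&1&0&1\\1&0&1&1\end{pmatrix}.$$ For any fixed positive integer $m_0$, we have $\operatorname{sat}(m_0,n,S)=\Theta(n)$ and $\operatorname{sat}(m_0,n,S')=\Theta(n)$ as $n\to\infty$.
   Context: All matrices are 0-1 matrices. A matrix $M$ contains a pattern $P$ if some submatrix of $M$ (obtained by deleting rows and columns) can be turned into $P$ by changing some number (possibly zero) of its ones to zeroes. The weight is the number of $1$ entries. $M$ is $P$-saturated if $M$ does not contain $P$, but changing any $0$ entry of $M$ to a $1$ yields a matrix containing $P$. $\operatorname{sat}(m,n,P)$ is the minimum weight of an $m\times n$ $P$-saturated matrix. *)

(* Defs.v *)
From HB Require Import structures.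
From mathcomp Require Import all_boot all_algebra.
Set Implicit Arguments.
Unset Strict Implicit.
Unset Printing Implicit Defensive.

(* A 0-1 matrix is a matrix of booleans, [true] standing for the entry 1. *)

Definition weight (m n : nat) (M : 'M[bool]_(m, n)) : nat :=
  #|[set ij : 'I_m * 'I_n | M ij.1 ij.2]|.

Definition increasing (k m : nat) (f : {ffun 'I_k -> 'I_m}) : bool :=
  [forall i : 'I_k, forall j : 'I_k, (i < j)%N ==> (f i < f j)%N].

(* Deleting rows and columns of [M] yields exactly the [mxsub f g M] with [f]
   and [g] strictly increasing. *)
Definition contains (k l m n : nat)
    (P : 'M[bool]_(k, l)) (M : 'M[bool]_(m, n)) : bool :=
  [exists f : {ffun 'I_k -> 'I_m}, exists g : {ffun 'I_l -> 'I_n},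
    [&& increasing f, increasing g
      & [forall i, forall j, P i j ==> mxsub f g M i j]]].

Definition set_one (m n : nat) (M : 'M[bool]_(m, n)) (i : 'I_m) (j : 'I_n) :
    'M[bool]_(m, n) :=
  \matrix_(a, b) (((a == i) && (b == j)) || M a b).

Definition saturated (k l : nat) (P : 'M[bool]_(k, l)) (m n : nat)
    (M : 'M[bool]_(m, n)) : bool :=
  ~~ contains P M &&
  [forall i, forall j, ~~ M i j ==> contains P (set_one M i j)].

(* The default matrix [const_mx true] only matters when no saturated matrix
   exists, which cannot happen if [P] has a one: see [saturated_exists] and
   [sat_spec] below. *)
Definition sat (m n k l : nat) (P : 'M[bool]_(k, l)) : nat :=
  weight [arg min_(M < (const_mx true : 'M[bool]_(m, n)) | saturated P M)
            weight M].

Lemma saturated_exists (k l : nat) (P : 'M[bool]_(k, l)) (m n : nat)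
    (i : 'I_k) (j : 'I_l) :
  P i j -> exists M : 'M[bool]_(m, n), saturated P M.
Proof.
move=> Pij.
have P0 : ~~ contains P (const_mx false : 'M[bool]_(m, n)).
  apply/negP => /existsP[f /existsP[g /and3P[_ _ /forallP/(_ i)/forallP/(_ j)]]].
  by rewrite Pij !mxE.
exists [arg max_(M > const_mx false | ~~ contains P M) weight M].
case: arg_maxnP => // M PM maxM; rewrite /saturated PM /=.
apply/forallP => a; apply/forallP => b; apply/implyP => Mab.
apply: contraT => /maxM /=; rewrite leqNgt => /negP[].
apply/proper_card/properP; split.
  by apply/subsetP => -[c d]; rewrite !inE mxE /= => ->; rewrite orbT.
by exists (a, b); rewrite !inE ?mxE /= ?eqxx.
Qed.

Lemma sat_spec (m n k l : nat) (P : 'M[bool]_(k, l)) :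
  (exists M : 'M[bool]_(m, n), saturated P M) ->
  (exists2 M : 'M[bool]_(m, n), saturated P M & weight M = sat m n P) /\
  (forall M : 'M[bool]_(m, n), saturated P M -> (sat m n P <= weight M)%N).
Proof.
move=> [M0 PM0].
have [M1 [PM1 minM1]] : exists M1 : 'M[bool]_(m, n), saturated P M1 /\
    forall M : 'M[bool]_(m, n), saturated P M -> (weight M1 <= weight M)%N.
  by case: (arg_minnP (@weight m n) PM0) => M1; exists M1.
have -> : sat m n P = weight M1; last by split; [exists M1|].
rewrite /sat /arg_min /extremum; case: pickP => [M /andP[PM /forallP leM] | /(_ M1)].
  apply/eqP; rewrite eqn_leq minM1 // andbT.
  by have /implyP := leM M1; apply.
rewrite /= PM1 /= => /negP[]; apply/forallP => M; apply/implyP.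
exact: minM1.
Qed.

Definition matrix_of_rows (k l : nat) (s : seq (seq nat)) : 'M[bool]_(k, l) :=
  \matrix_(i, j) (nth 0%N (nth [::] s i) j == 1%N).

Definition patS : 'M[bool]_(2, 4) :=
  matrix_of_rows 2 4 [:: [:: 0; 1; 0; 1];
                         [:: 1; 0; 1; 0]]%N.

Definition patS' : 'M[bool]_(2, 4) :=
  matrix_of_rows 2 4 [:: [:: 0; 1; 0; 1];
                         [:: 1; 0; 1; 1]]%N.

(* Main.v *)
Require Import Defs.
From mathcomp Require Import all_boot all_order all_algebra.
From mathcomp Require Import all_classical all_reals all_analysis.
From mathcomp Require Import zify.
Import GRing.Theory Num.Theory.
Import numFieldNormedType.Exports.
Local Open Scope classical_set_scope.
Local Open Scope ring_scope.

(** A matrix with [m] rows and [n] columns has weight at most [m * n], so only a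
linear lower bound is at stake. It follows from a structural fact: if [0 < m], a
saturated matrix for either pattern has no empty column, hence weight at least
[n] ([saturated_column_nonempty]).

Suppose that column [j] is empty. Putting a one in row [i] of column [j] creates
the pattern, so every row [i] comes with a partner row completing the pattern.
Listing the ways in which the new one can be used gives four roles
([role_of_row]). The first row must be the top row of its occurrence and the
last row the bottom row; the point is that these requirements cannot be
propagated consistently through the rows in between.

The rows that matter are those with ones on both sides of [j]; call their set
[X]. Looking at the last row with a one before [j] shows that [X] is not empty.
Two of the four roles are impossible in [X], because the partner row together
with the ones of the given row on the far side of [j] would already be an
occurrence. In the other two roles the partner again lies in [X], so from
each row of [X] one can move to another row of [X], either downwards (the row
was a top row) or upwards (the row was a bottom row). Attach to each row of [X]
the interval from its first to its last one before [j]. Since the matrix avoids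
the pattern, a downward move goes to an interval that starts no earlier than
the current one ends, and an upward move never decreases the right end, and
goes to an interval ending strictly after the start of the current one. Such a
system of moves cannot exist on a finite nonempty set ([no_forced_moves]):
among the rows whose right end is maximal, the highest one has to move down to
a row whose interval is reduced to that maximal point, and from such a row only
further downward moves to rows of the same kind are possible.

The two patterns differ by a single one in their last column, and the argument
uses the last column of an occurrence only to complete another occurrence, so
one argument with a boolean parameter serves both. *)

(** * Moves between intervals *)

(** Right ends never decrease along a move, so the rows where [Q] is maximal are
closed under moves. The topmost of them, [y], cannot move up, and its downward
move reaches a degenerate interval at the maximum. A degenerate interval there
excludes upward moves, since [P x < Q b] would exceed the maximum; so the lowest
such row [s] has no move left. *)
Lemma no_forced_moves {m : nat} (X : {set 'I_m}) (P Q : 'I_m -> nat)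
    (x0 : 'I_m) :
  x0 \in X ->
  (forall x, x \in X -> (P x <= Q x)%N) ->
  (forall x, x \in X ->
     (exists2 t, t \in X & (x < t)%N /\ (Q x <= P t)%N) \/
     (exists2 b, b \in X & [/\ (b < x)%N, (P x < Q b)%N & (Q x <= Q b)%N])) ->
  False.
Proof.
move=> Xx0 lePQ move_from.
have [z Xz maxQ] : exists2 z, z \in X & forall x, x \in X -> (Q x <= Q z)%N.
  by case: (@arg_maxnP _ x0 [in X] Q Xx0) => z; exists z.
have zz : (z \in X) && (Q z <= Q z)%N by rewrite Xz leqnn.
case: (@arg_minnP _ z (fun x => (x \in X) && (Q z <= Q x)%N) val zz) =>
  y /andP[Xy leQy] min_y.
have [t Xt leQt] : exists2 t, t \in X & (Q z <= P t)%N.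
  case: (move_from y Xy) => [[t Xt [_ leQ]] | [b Xb [lt_by _ leQ]]].
    by exists t => //; apply: leq_trans leQ.
  have /min_y : (b \in X) && (Q z <= Q b)%N by rewrite Xb (leq_trans leQy).
  by rewrite leqNgt lt_by.
have tt : (t \in X) && (Q z <= P t)%N by rewrite Xt.
case: (@arg_maxnP _ t (fun x => (x \in X) && (Q z <= P x)%N) val tt) =>
  s /andP[Xs leQs] max_s.
case: (move_from s Xs) => [[r Xr [lt_sr leQ]] | [b Xb [_ ltQ _]]].
  have /max_s : (r \in X) && (Q z <= P r)%N.
    by rewrite Xr (leq_trans leQs) // (leq_trans (lePQ s Xs)).
  by rewrite /= leqNgt lt_sr.
by have := leq_trans (leq_ltn_trans leQs ltQ) (maxQ b Xb); rewrite ltnn.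
Qed.

(** * Occurrences of the two patterns *)

(** The parameter [e] says whether the bottom row has a one in the last column:
this is the only entry in which the two patterns differ. *)
Definition pat (e : bool) : 'M[bool]_(2, 4) := if e then patS' else patS.

Definition occurs (e : bool) {m n : nat} (M : 'M[bool]_(m, n))
    (u v : 'I_m) (c1 c2 c3 c4 : 'I_n) : bool :=
  [&& (u < v)%N, (c1 < c2)%N, (c2 < c3)%N, (c3 < c4)%N,
      M v c1, M u c2, M v c3, M u c4 & e ==> M v c4].

Lemma contains_patP (e : bool) {m n : nat} (M : 'M[bool]_(m, n)) :
  contains (pat e) M <->
  exists u v c1 c2 c3 c4, occurs e M u v c1 c2 c3 c4.
Proof.
split.
  move=> /existsP[f /existsP[g /and3P[/forallP incf /forallP incg /forallP PM]]].
  have entry i k : pat e i k -> M (f i) (g k).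
    by move=> Pik; have /forallP/(_ k)/implyP/(_ Pik) := PM i; rewrite mxE.
  have incf2 (i k : 'I_2) : (i < k)%N -> (f i < f k)%N.
    by have /forallP/(_ k)/implyP := incf i.
  have incg2 (i k : 'I_4) : (i < k)%N -> (g i < g k)%N.
    by have /forallP/(_ k)/implyP := incg i.
  exists (f (inord 0)), (f (inord 1)), (g (inord 0)), (g (inord 1)),
    (g (inord 2)), (g (inord 3)).
  apply/and5P; split;
    try by [apply: incf2; rewrite !inordK | apply: incg2; rewrite !inordK].
  apply/and5P; split;
    try by apply: entry; rewrite /pat; case: (e); rewrite !mxE !inordK.
  by apply/implyP => et; apply: entry; rewrite et !mxE !inordK.
move=> [u [v [c1 [c2 [c3 [c4 /and5P[uv c12 c23 c34
  /and5P[M1 M2 M3 M4 /implyP M5]]]]]]]].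
apply/existsP; exists [ffun i : 'I_2 => if val i == 0%N then u else v].
apply/existsP; exists [ffun k : 'I_4 => nth c1 [:: c1; c2; c3; c4] k].
apply/and3P; split.
- apply/forallP => -[[|[|[]]] // i]; apply/forallP => -[[|[|[]]] // k];
  by apply/implyP; rewrite !ffunE.
- apply/forallP => -[[|[|[|[|[]]]]] // i]; apply/forallP => -[[|[|[|[|[]]]]] // k];
  by apply/implyP; rewrite !ffunE //= => _; lia.
- apply/forallP => -[[|[|[]]] // i]; apply/forallP => -[[|[|[|[|[]]]]] // k];
  apply/implyP; rewrite [in X in _ -> X]mxE !ffunE //=; case: e M5 => M5;
  by rewrite !mxE //= => _; apply: M5.
Qed.

(** * Rows seen from an empty column *)

(** The ways in which a new one in row [i] of the empty column [j] can take part
in an occurrence, that is, what the rest of that occurrence is in the given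
matrix. The name of a constructor says whether [i] is the top or the bottom row
of the occurrence and which of its four columns is [j]. In a bottom row the new
one is never in the fourth column: the top row has a one there, and it would have
to be an old one, in column [j]. For the same reason [Top4] needs [~~ e]. *)
Variant role (e : bool) {m n : nat} (M : 'M[bool]_(m, n)) (j : 'I_n)
    (i : 'I_m) : Prop :=
| Top2 (t : 'I_m) (c1 c3 c4 : 'I_n) of (i < t)%N & (c1 < j)%N & (j < c3)%N
    & (c3 < c4)%N & M t c1 & M t c3 & M i c4 & e ==> M t c4
| Top4 (t : 'I_m) (c1 c2 c3 : 'I_n) of (i < t)%N & (c1 < c2)%N & (c2 < c3)%N
    & (c3 < j)%N & M t c1 & M i c2 & M t c3 & ~~ e
| Bot1 (b : 'I_m) (c2 c3 c4 : 'I_n) of (b < i)%N & (j < c2)%N & (c2 < c3)%N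
    & (c3 < c4)%N & M b c2 & M i c3 & M b c4 & e ==> M i c4
| Bot3 (b : 'I_m) (c1 c2 c4 : 'I_n) of (b < i)%N & (c1 < c2)%N & (c2 < j)%N
    & (j < c4)%N & M i c1 & M b c2 & M b c4 & e ==> M i c4.

(** Without the new one the occurrence would already be in [M]; so the new one is
used, and its row and its column in the occurrence determine the role. *)
Lemma role_of_row {e : bool} {m n : nat} {M : 'M[bool]_(m, n)} {j : 'I_n} :
  saturated (pat e) M -> (forall i, ~~ M i j) -> forall i, role e M j i.
Proof.
move=> /andP[/negP free /forallP sat] Mj0 i.
have /contains_patP := implyP (forallP (sat i) j) (Mj0 i).
move=> [u [v [c1 [c2 [c3 [c4 /and5P[uv c12 c23 c34
  /and5P[M1 M2 M3 M4 M5]]]]]]]].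
have old a c : set_one M i j a c -> ~~ ((a == i) && (c == j)) -> M a c.
  by rewrite mxE => /orP[->|].
have offj a : a != i -> set_one M i j a j = false.
  by move=> /negPf ai; rewrite mxE ai /= (negPf (Mj0 a)).
have offi a c : a != i -> set_one M i j a c -> M a c.
  by move=> /negPf ai; rewrite mxE ai.
have [ui | ui] := eqVneq u i.
  have vi : v != i by rewrite -ui; apply/eqP => vu; move: uv; rewrite vu ltnn.
  move/(offi v c1 vi): M1 => M1; move/(offi v c3 vi): M3 => M3.
  have [c4j | c4j] := eqVneq c4 j.
    move: M5; rewrite c4j offj // implybF => e0.
    apply: (@Top4 _ _ _ _ _ _ v c1 c2 c3); rewrite // -?ui -?c4j //.
    apply: old => //; apply/nandP; right.
    by rewrite -c4j -val_eqE /= neq_ltn (ltn_trans c23).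
  have M4' : M u c4 by apply: old => //; rewrite (negPf c4j) andbF.
  have M5' : e ==> M v c4.
    by apply/implyP => et; apply: (offi v c4 vi); apply: implyP M5 et.
  have [c2j | c2j] := eqVneq c2 j.
    by apply: (@Top2 _ _ _ _ _ _ v c1 c3 c4); rewrite // -?ui -?c2j.
  have M2' : M u c2 by apply: old => //; rewrite (negPf c2j) andbF.
  case: free; apply/contains_patP; exists u, v, c1, c2, c3, c4.
  by rewrite /occurs uv c12 c23 c34 M1 M2' M3 M4' M5'.
move/(offi u c2 ui): M2 => M2; move/(offi u c4 ui): M4 => M4.
have c4j : c4 != j by apply/eqP => c4j; move: M4; rewrite c4j (negPf (Mj0 u)).
have M5' : e ==> M v c4.
  apply/implyP => et; apply: old; last by rewrite (negPf c4j) andbF.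
  exact: implyP M5 et.
have [vi | vi] := eqVneq v i; last first.
  case: free; apply/contains_patP; exists u, v, c1, c2, c3, c4.
  by rewrite /occurs uv c12 c23 c34 (offi v c1) // M2 (offi v c3) // M4 M5'.
have [c1j | c1j] := eqVneq c1 j.
  apply: (@Bot1 _ _ _ _ _ _ u c2 c3 c4); rewrite // -?vi -?c1j //.
  apply: old => //; apply/nandP; right.
  by rewrite -c1j -val_eqE /= neq_ltn (ltn_trans c12) ?orbT.
have M1' : M v c1 by apply: old => //; rewrite (negPf c1j) andbF.
have [c3j | c3j] := eqVneq c3 j.
  by apply: (@Bot3 _ _ _ _ _ _ u c1 c2 c4); rewrite // -?vi -?c3j.
have M3' : M v c3 by apply: old => //; rewrite (negPf c3j) andbF.
case: free; apply/contains_patP; exists u, v, c1, c2, c3, c4.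
by rewrite /occurs uv c12 c23 c34 M1' M2 M3' M4 M5'.
Qed.

(** The rows with ones on both sides of an empty column would satisfy the
hypotheses of [no_forced_moves], with [P] and [Q] the positions of the first and
the last one before that column. *)
Lemma saturated_column_nonempty {e : bool} {m n : nat} {M : 'M[bool]_(m, n)} :
  (0 < m)%N -> saturated (pat e) M -> forall j, exists i, M i j.
Proof.
move=> m_gt0 satM j; apply/existsP; apply: contraT.
rewrite negb_exists => /forallP Mj0.
have roleM := role_of_row satM Mj0.
have free u v c1 c2 c3 c4 : ~~ occurs e M u v c1 c2 c3 c4.
  apply/negP => occ; case/andP: satM => /negP[].
  by apply/contains_patP; exists u, v, c1, c2, c3, c4.
pose L i := [exists c : 'I_n, (c < j)%N && M i c].
pose X := [set i | L i & [exists c : 'I_n, (j < c)%N && M i c]]%SET.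
have inL i (c : 'I_n) : (c < j)%N -> M i c -> L i.
  by move=> cj Mic; apply/existsP; exists c; rewrite cj.
have inX i (c d : 'I_n) : (c < j)%N -> M i c -> (j < d)%N -> M i d -> i \in X.
  move=> cj Mic jd Mid; rewrite inE (inL i c) //=.
  by apply/existsP; exists d; rewrite jd.
(* The first row is a top row, and its partner has a one before [j]. *)
have [l0 Ll0] : exists l, L l.
  case: (roleM (Ordinal m_gt0)) => k c1 c2 c3 //=.
  - by move=> _ ? _ _ ? _ _ _; exists k; apply: (inL k c1).
  - by move=> _ _ _ ? _ _ ? _; exists k; apply: (inL k c3).
(* The last row [l] in [L] cannot be a top row, since its partner would be a later
   row in [L]; as a bottom row, its partner has ones on both sides of [j]. *)
have [x0 Xx0] : exists x, x \in X.
  case: (@arg_maxnP _ l0 L val Ll0) => l /existsP[c /andP[cj Mlc]] maxl.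
  case: (roleM l) => k c1 c2 c3.
  - move=> lk c1j _ _ M1 _ _ _; have /maxl := inL k c1 c1j M1.
    by rewrite /= leqNgt lk.
  - move=> lk _ _ c3j _ _ M3 _; have /maxl := inL k c3 c3j M3.
    by rewrite /= leqNgt lk.
  - move=> kl jc1 c12 c23 M1 M2 M3 M4; have /negP[] := free k l c c1 c2 c3.
    by rewrite /occurs kl (ltn_trans cj) // c12 c23 Mlc M1 M2 M3.
  - move=> kl c12 c2j jc3 M1 M2 M3 _; exists k.
    exact: (inX k c2 c3).
(* A row of [X] has its first one before [j], so [P] can be computed over all
   columns; the value [n] stands for no entry. *)
pose P x := let c := [arg min_(c < j) (if M x c then val c else n)] in
  (if M x c then val c else n).
pose Q x := \max_(c in [pred c : 'I_n | M x c && (c < j)%N]) val c.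
have Pmin x (c : 'I_n) : M x c -> (P x <= c)%N.
  move=> Mxc; rewrite /P; case: arg_minnP => // d _ /(_ c isT).
  by rewrite Mxc.
have Pval x : x \in X -> exists2 c : 'I_n, M x c & P x = c.
  rewrite inE => /andP[/existsP[c /andP[_ Mxc]] _]; have := Pmin x c Mxc.
  rewrite /P; case: ifP => [Mxd _|_]; last by rewrite leqNgt ltn_ord.
  by eexists; first exact: Mxd.
have Qmax x (c : 'I_n) : M x c -> (c < j)%N -> (c <= Q x)%N.
  by move=> Mxc cj; apply: (@leq_bigmax_cond _ _ _ c); rewrite inE Mxc.
have Qval x : x \in X -> exists2 c : 'I_n, M x c && (c < j)%N & Q x = c.
  rewrite inE => /andP[/existsP[c /andP[cj Mxc]] _].
  have [] := @eq_bigmax_cond _ [pred c : 'I_n | M x c && (c < j)%N] val.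
    by apply/card_gt0P; exists c; rewrite inE Mxc.
  by move=> d Mxd Qd; exists d; rewrite // /Q Qd.
exfalso; apply: (no_forced_moves X P Q x0 Xx0) => [x Xx | x Xx].
  by have [c /andP[Mxc cj] ->] := Qval x Xx; apply: Pmin.
have [q /andP[Mxq qj] Qx] := Qval x Xx.
have := Xx; rewrite inE => /andP[_ /existsP[r /andP[jr Mxr]]].
case: (roleM x) => k c1 c2 c3.
- (* Interleaved intervals, [k] starting before the end of [x], would give the
     first two columns of an occurrence; the last two are those of the role. *)
  move=> xk c1j jc2 c23 M1 M2 M3 M4; left.
  have Xk : k \in X by apply: (inX k c1 c2).
  exists k => //; split=> //; rewrite leqNgt; apply/negP.
  have [p Mkp ->] := Pval k Xk; rewrite Qx => pq.
  have /negP[] := free x k p q c2 c3.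
  by rewrite /occurs xk pq (ltn_trans qj) // c23 Mkp Mxq M2 M3.
- (* The three ones before [j] continue with a one of [x] after [j]. *)
  move=> xk c12 c23 c3j M1 M2 M3 e0.
  have /negP[] := free x k c1 c2 c3 r.
  by rewrite /occurs xk c12 c23 (ltn_trans c3j) // M1 M2 M3 Mxr (negPf e0).
- (* The three columns after [j] are preceded by a one of [x] before [j]. *)
  move=> kx jc1 c12 c23 M1 M2 M3 M4.
  have /negP[] := free k x q c1 c2 c3.
  by rewrite /occurs kx (ltn_trans qj) // c12 c23 Mxq M1 M2 M3.
- move=> kx c12 c2j jc3 M1 M2 M3 M4; right.
  have leQ := Qmax k c2 M2 c2j.
  exists k; first exact: (inX k c2 c3).
  split=> //; first by apply: leq_ltn_trans (Pmin x c1 M1) (leq_trans c12 leQ).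
  (* Otherwise the last one of [x] before [j] lies to the right of the one of [k]
     in column [c2], and can serve as the third column. *)
  rewrite leqNgt; apply/negP; rewrite Qx => ltq.
  have /negP[] := free k x c1 c2 q c3.
  rewrite /occurs kx c12 (leq_ltn_trans leQ ltq) (ltn_trans qj) //.
  by rewrite M1 M2 Mxq M3.
Qed.

(** * Weight bounds *)

Lemma leq_weight_of_columns {m n : nat} (M : 'M[bool]_(m, n)) :
  (forall j, exists i, M i j) -> (n <= weight M)%N.
Proof.
move=> colM.
rewrite -[leqLHS]card_ord; apply: leq_trans (leq_imset_card snd _).
apply: subset_leq_card; apply/fintype.subsetP => j _; have [i Mij] := colM j.
by apply/imsetP; exists (i, j); rewrite ?inE.
Qed.

Lemma weight_leq {m n : nat} (M : 'M[bool]_(m, n)) : (weight M <= m * n)%N.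
Proof. by apply: leq_trans (max_card _) _; rewrite card_prod !card_ord. Qed.

Lemma sat_pat_bounds (e : bool) (m n : nat) :
  (0 < m)%N -> (n <= sat m n (pat e) <= m * n)%N.
Proof.
move=> m_gt0.
have pat01 : pat e (inord 0) (inord 1) by case: e; rewrite !mxE !inordK.
have [[M satM <-] _] := sat_spec (saturated_exists m n pat01).
rewrite leq_weight_of_columns ?weight_leq //.
exact: saturated_column_nonempty satM.
Qed.

Lemma Theta_linear (R : realType) (m : nat) (f : nat -> nat) :
  (forall n, n <= f n <= m * n)%N ->
  (fun n : nat => (f n)%:R : R) =Theta_\oo (fun n : nat => n%:R : R).
Proof.
move=> bounds.
have boundsn n := andP (bounds n).
rewrite eqThetaE bigThetaE eqOmegaO; split; apply/eqO_exP.
  exists (m.+1)%:R; first by rewrite /= ltr0n.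
  apply: nearW => n /=; rewrite !normr_nat -natrM ler_nat.
  by have [_ /leq_trans->] := boundsn n; rewrite // leq_mul2r leqnSn orbT.
exists 1 => //; apply: nearW => n /=.
by rewrite !normr_nat mul1r ler_nat; have [] := boundsn n.
Qed.

Theorem theorem7p11 (R : realType) (m0 : nat) (hm0 : (0 < m0)%N) :
  ((fun n : nat => (sat m0 n patS)%:R : R)
     =Theta_\oo (fun n : nat => n%:R : R)) /\
  ((fun n : nat => (sat m0 n patS')%:R : R)
     =Theta_\oo (fun n : nat => n%:R : R)).
Proof.
split; apply: (@Theta_linear R m0) => n.
  exact: (sat_pat_bounds false).
exact: (sat_pat_bounds true).
Qed.
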